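(* Let $\Gamma^1=(G,\sigma_1,\mu_1)$ be a $\gamma_1$-regular signed graph on $n_1$ vertices and $m_1$ edges, let $\theta$ be any $r$-orientation of the edges of $\Gamma^1$, and let $\Gamma^2=(H,\sigma_2,\mu_2)$ be an arbitrary signed graph on $n_2$ vertices. Let $\lambda_1(\Gamma^1),\dots,\lambda_{n_1}(\Gamma^1)$ be the eigenvalues of $A(\Gamma^1)$. Then $$f_{A((\Gamma^1\boxdot\Gamma^2)_\theta)}(\lambda)=\lambda^{m_1-n_1}\big(f_{A(\Gamma^2)}(\lambda)\big)^{n_1}\prod_{j=1}^{n_1}\Big(\lambda^2-\big(1+\lambda\,\Sigma_{A(\Gamma^2)}(\lambda)\big)\big(\lambda_j(\Gamma^1)+\gamma_1\big)\Big).$$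
   Context: A signed graph $\Gamma=(G,\sigma,\mu)$ has a finite simple graph $G$ with vertices $v_1,\dots,v_n$, signature $\sigma:E(G)\to\{\pm1\}$ and marking $\mu:V(G)\to\{\pm1\}$; $\mu(\Gamma)=(\mu(v_1),\dots,\mu(v_n))^T$. $A(\Gamma)$ has $(i,j)$ entry $\sigma(v_iv_j)$ if $v_i\sim v_j$ and $0$ otherwise. $\gamma$-regular means all degrees equal $\gamma$. $f_M(\lambda)=\det(\lambda I-M)$. The signed $N$-coronal is the rational function $\Sigma_N(X)=\mu(\Gamma)^T(XI_n-N)^{-1}\mu(\Gamma)$. An $r$-orientation of $(G,\sigma)$ is a map $\theta:V(G)\times E(G)\to\{-1,0,1\}$ with $\theta(w,uv)=0$ for $w\notin\{u,v\}$, $\theta(u,uv)\in\{\pm1\}$ at endpoints, and $\theta(u,uv)\theta(v,uv)=\sigma(uv)$. The subdivision graph $S(\Gamma^1_\theta)$ is obtained by inserting a new vertex $v_e$ into each edge $e$ of $\Gamma^1$, the edge $v_iv_e$ ($v_i$ an endpoint of $e$) having sign $\theta(v_i,e)$. With $V(\Gamma^1)=\{v_1,\dots,v_{n_1}\}$, the subdivision vertex neighbourhood corona $(\Gamma^1\boxdot\Gamma^2)_\theta$ is obtained from $S(\Gamma^1_\theta)$ and $n_1$ disjoint copies of $\Gamma^2$ by joining, for each $t$, every inserted vertex $v_e$ with $e$ incident to $v_t$ to every vertex $u$ of the $t$-th copy, the edge $v_eu$ having sign $\theta(v_t,e)\mu_2(u)$, where $\mu_2(u)$ is the marking of the corresponding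 vertex of $\Gamma^2$. *)

(* Defs.v *)
From HB Require Import structures.
From mathcomp Require Import all_boot all_order all_algebra.

Set Implicit Arguments.
Unset Strict Implicit.
Unset Printing Implicit Defensive.

Import GRing.Theory.
Local Open Scope ring_scope.

Notation "x %:F" := (@FracField.tofrac _ x) : ring_scope.

Definition is_sign (x : int) : Prop := x = 1 \/ x = -1.

(* The signature is a function of the two endpoints; its values on
   non-adjacent pairs are meaningless and never used. *)
Record sigraph (V : finType) := SiGraph {
  adj : rel V;
  sgn : V -> V -> int;
  adj_sym : symmetric adj;
  adj_irr : irreflexive adj;
  sgn_sym : forall u v, adj u v -> sgn u v = sgn v u;
  sgn_sign : forall u v, adj u v -> is_sign (sgn u v)
}.

Record sgraph (V : finType) := SGraph {
  sg_graph :> sigraph V;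
  mark : V -> int;
  mark_sign : forall v, is_sign (mark v)
}.

Definition edges (V : finType) (G : sigraph V) : {set {set V}} :=
  [set e : {set V} | [exists u, exists v, adj G u v && (e == [set u; v])]].

Notation edge G := {e : {set _} | e \in edges G}.

Definition regular (V : finType) (G : sigraph V) (k : nat) : Prop :=
  forall v, #|[set w | adj G v w]| = k.

(* Rows and columns follow the enumeration of V. *)
Definition adjmx (R : pzRingType) (V : finType) (G : sigraph V) : 'M[R]_#|V| :=
  \matrix_(i, j) (if adj G (enum_val i) (enum_val j)
                  then (sgn G (enum_val i) (enum_val j))%:~R else 0).

Definition markvec (R : pzRingType) (V : finType) (G : sgraph V) : 'cV[R]_#|V| :=
  \col_i (mark G (enum_val i))%:~R.

Definition coronal (R : fieldType) (V : finType) (G : sgraph V)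
    (N : 'M[R]_#|V|) : {fraction {poly R}} :=
  ((markvec _ G)^T
     *m invmx (('X%:F)%:M - map_mx (fun a : R => (a%:P)%:F) N)
     *m markvec _ G) 0 0.

Record rorientation (V : finType) (G : sigraph V) := ROrientation {
  theta :> V -> edge G -> int;
  theta_out : forall w (e : edge G), w \notin val e -> theta w e = 0;
  theta_end : forall w (e : edge G), w \in val e -> is_sign (theta w e);
  theta_sgn : forall u v (e : edge G), adj G u v -> val e = [set u; v] ->
    theta u e * theta v e = sgn G u v
}.

Section Subdivision.
Variables (V : finType) (G : sigraph V) (th : rorientation G).

Definition subdiv_vertex : finType := (V + edge G)%type.

Definition subdiv_adj (x y : subdiv_vertex) : bool :=
  match x, y with
  | inl v, inr e | inr e, inl v => v \in val e
  | _, _ => false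
  end.

Definition subdiv_sgn (x y : subdiv_vertex) : int :=
  match x, y with
  | inl v, inr e | inr e, inl v => th v e
  | _, _ => 0
  end.

Fact subdiv_adj_sym : symmetric subdiv_adj.
Proof. by move=> [u|e] [v|f]. Qed.

Fact subdiv_adj_irr : irreflexive subdiv_adj.
Proof. by case. Qed.

Fact subdiv_sgn_sym x y : subdiv_adj x y -> subdiv_sgn x y = subdiv_sgn y x.
Proof. by case: x y => [u|e] [v|f]. Qed.

Fact subdiv_sgn_sign x y : subdiv_adj x y -> is_sign (subdiv_sgn x y).
Proof. by case: x y => [u|e] [v|f] //= /(theta_end th). Qed.

Definition subdivision : sigraph subdiv_vertex :=
  SiGraph subdiv_adj_sym subdiv_adj_irr subdiv_sgn_sym subdiv_sgn_sign.

End Subdivision.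

Section Corona.
Variables (V1 V2 : finType) (G1 : sigraph V1) (th : rorientation G1).
Variable (G2 : sgraph V2).

(* inr (t, u) is the vertex u in the t-th copy of G2. *)
Definition corona_vertex : finType := (subdiv_vertex G1 + V1 * V2)%type.

Definition corona_adj (x y : corona_vertex) : bool :=
  match x, y with
  | inl a, inl b => adj (subdivision th) a b
  | inl (inr e), inr (t, _) | inr (t, _), inl (inr e) => t \in val e
  | inr (s, u), inr (t, v) => (s == t) && adj G2 u v
  | _, _ => false
  end.

Definition corona_sgn (x y : corona_vertex) : int :=
  match x, y with
  | inl a, inl b => sgn (subdivision th) a b
  | inl (inr e), inr (t, u) | inr (t, u), inl (inr e) => th t e * mark G2 u
  | inr (_, u), inr (_, v) => sgn G2 u v
  | _, _ => 0
  end.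

Fact corona_adj_sym : symmetric corona_adj.
Proof.
by move=> [[u|e]|[s u]] [[v|f]|[t v]] //=; rewrite eq_sym adj_sym.
Qed.

Fact corona_adj_irr : irreflexive corona_adj.
Proof. by move=> [[u|e]|[s u]] //=; rewrite adj_irr andbF. Qed.

Fact corona_sgn_sym x y : corona_adj x y -> corona_sgn x y = corona_sgn y x.
Proof.
by case: x y => [[u|e]|[s u]] [[v|f]|[t v]] //= /andP[_ /sgn_sym].
Qed.

Fact is_signM x y : is_sign x -> is_sign y -> is_sign (x * y).
Proof. by move=> [] -> [] ->; [left|right|right|left]. Qed.

Fact corona_sgn_sign x y : corona_adj x y -> is_sign (corona_sgn x y).
Proof.
case: x y => [[u|e]|[s u]] [[v|f]|[t v]] //=; try exact: theta_end.
- by move=> te; apply: is_signM; [exact: theta_end | exact: mark_sign].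
- by move=> te; apply: is_signM; [exact: theta_end | exact: mark_sign].
- by case/andP=> _ /sgn_sign.
Qed.

Definition corona : sigraph corona_vertex :=
  SiGraph corona_adj_sym corona_adj_irr corona_sgn_sym corona_sgn_sign.

End Corona.

(* lam lists the eigenvalues of M with their multiplicities. *)
Definition eigenvalues_of (R : fieldType) (n : nat) (M : 'M[R]_n)
    (lam : 'I_n -> R) : Prop :=
  char_poly M = \prod_(j < n) ('X - (lam j)%:P).

(* Main.v *)
Require Import Defs.
From HB Require Import structures.
From mathcomp Require Import all_boot all_order all_algebra.
From mathcomp Require Import fingroup perm.
From mathcomp Require Import ring.

Set Implicit Arguments.
Unset Strict Implicit.
Unset Printing Implicit Defensive.

Import GRing.Theory.
Local Open Scope ring_scope.

(* With [B] the vertex-edge matrix of [theta], [mu] the marking of the second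
   graph and [A2] its adjacency matrix, the corona has characteristic matrix
     [ x I      -B           0                ]
     [ -B^T     x I          -B^T (x) mu^T    ]
     [ 0        -B (x) mu    I (x) (x I - A2) ].
   The Schur complement of the last block replaces the middle entry by
   x I - Sigma B^T B, that of the first one then yields
   x I - (Sigma + 1/x) B^T B, and Sylvester's identity exchanges B^T B with
   B B^T, which is A1 + gamma I by regularity. *)

(** * Matrices indexed by finite types *)

Definition fmx (R : Type) (S T : finType) (M : S -> T -> R) :
    'M[R]_(#|S|, #|T|) :=
  \matrix_(i, j) M (enum_val i) (enum_val j).

Lemma eq_fmx (R : Type) (S T : finType) (M N : S -> T -> R) :
  (forall x y, M x y = N x y) -> fmx M = fmx N.
Proof. by move=> eqMN; apply/matrixP => i j; rewrite !mxE. Qed.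

Lemma fmx_scalar (R : pzSemiRingType) (T : finType) (a : R) :
  fmx (fun x y : T => a *+ (x == y)) = a%:M.
Proof. by apply/matrixP => i j; rewrite !mxE (inj_eq enum_val_inj). Qed.

Lemma mul_fmx (R : pzSemiRingType) (S T U : finType)
    (M : S -> T -> R) (N : T -> U -> R) :
  fmx M *m fmx N = fmx (fun x z => \sum_y M x y * N y z).
Proof.
apply/matrixP => i j; rewrite !mxE [RHS]big_enum_val.
by apply: eq_bigr => k _; rewrite !mxE.
Qed.

Lemma fmx_tr (R : Type) (S T : finType) (M : S -> T -> R) :
  (fmx M)^T = fmx (fun y x => M x y).
Proof. by apply/matrixP => i j; rewrite !mxE. Qed.

(** The Kronecker product I (x) M: one diagonal block [M] for each element of [S]. *)
Definition copies (R : pzSemiRingType) (S T : finType) (M : T -> T -> R)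
    (p q : S * T) : R :=
  M p.2 q.2 *+ (p.1 == q.1).

Lemma mul_copies (R : pzSemiRingType) (S T : finType) (M N : T -> T -> R) :
  fmx (copies (S := S) M) *m fmx (copies N) =
  fmx (copies (fun x z => \sum_y M x y * N y z)).
Proof.
rewrite mul_fmx; apply: eq_fmx => -[s x] [t z]; rewrite /copies /=.
rewrite -(pair_bigA _ (fun r y =>
  (M x y *+ (s == r)) * (N y z *+ (r == t)))) /=.
rewrite (bigD1 s) //= [X in _ + X]big1 ?addr0 => [|r /negPf rs].
  under eq_bigr do rewrite eqxx mulr1n mulrnAr.
  by rewrite sumrMnl.
by apply: big1 => y _; rewrite eq_sym rs mulr0n mul0r.
Qed.

(** * Determinants under change of enumeration *)

Section DetReindex.
Variable R : comPzRingType.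

(** Two enumerations differ by one permutation, applied to rows and columns alike, so its sign
    occurs squared. *)
Lemma det_reindex n (T : Type) (M : T -> T -> R) (g h : 'I_n -> T) :
  bijective g -> bijective h ->
  \det (\matrix_(i, j) M (g i) (g j)) = \det (\matrix_(i, j) M (h i) (h j)).
Proof.
move=> [g' gK g'K] [h' hK h'K].
have p_inj : injective (h' \o g).
  by apply: inj_comp; [exact: can_inj h'K | exact: can_inj gK].
pose p := perm p_inj; set A := (X in _ = \det X).
have -> : \matrix_(i, j) M (g i) (g j) = row_perm p (col_perm p A).
  by apply/matrixP => i j; rewrite !mxE !permE /= !h'K.
rewrite row_permE col_permE !det_mulmx !det_perm odd_permV mulrCA.
by rewrite -expr2 sqrr_sign mulr1.
Qed.

Lemma det_fmx_ord n (T : finType) (M : T -> T -> R) (g : 'I_n -> T) :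
  bijective g -> \det (fmx M) = \det (\matrix_(i, j) M (g i) (g j)).
Proof.
move=> g_bij; have En : n = #|T| by rewrite -(bij_eq_card g_bij) card_ord.
move: g g_bij; rewrite En => g g_bij; apply: det_reindex => //.
exact: enum_val_bij.
Qed.

Lemma det_fmx_bij (S T : finType) (M : T -> T -> R) (f : S -> T) :
  bijective f -> \det (fmx M) = \det (fmx (fun x y => M (f x) (f y))).
Proof.
move=> f_bij; rewrite (@det_fmx_ord _ _ M (f \o (@enum_val S predT))) //.
by apply: bij_comp => //; exact: enum_val_bij.
Qed.

(** Listing all of [S] and then all of [T] is an admissible enumeration of the sum, and it exhibits
    the blocks. *)
Lemma det_fmx_sum (S T : finType) (M : S + T -> S + T -> R) :
  \det (fmx M) =
  \det (block_mx (fmx (fun x y => M (inl x) (inl y)))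
                 (fmx (fun x y => M (inl x) (inr y)))
                 (fmx (fun x y => M (inr x) (inl y)))
                 (fmx (fun x y => M (inr x) (inr y)))).
Proof.
pose f (s : 'I_#|S| + 'I_#|T|) : S + T :=
  match s with inl i => inl (enum_val i) | inr j => inr (enum_val j) end.
pose f' (s : S + T) : 'I_#|S| + 'I_#|T| :=
  match s with inl i => inl (enum_rank i) | inr j => inr (enum_rank j) end.
rewrite (@det_fmx_ord _ _ M (f \o @split _ _)); last first.
  apply: bij_comp; last first.
    by exists (@unsplit _ _); [exact: splitK | exact: unsplitK].
  by exists f'; case=> i /=; rewrite ?enum_valK ?enum_rankK.
congr (\det _); apply/matrixP => i j; rewrite !mxE /=.
by case: (split i) => i'; rewrite !mxE; case: (split j) => j'; rewrite !mxE.
Qed.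

(** Induction on [n]: splitting off the copy at [ord0] leaves a block triangular matrix whose other
    diagonal block consists of [n] copies. *)
Lemma det_fmx_copies_ord n (T : finType) (M : T -> T -> R) :
  \det (fmx (copies (S := 'I_n) M)) =
  \det (fmx M) ^+ n.
Proof.
elim: n => [|n IHn].
  suff E : #|{: 'I_0 * T}| = 0%N.
    by set A := fmx _; move: A; rewrite E => A; rewrite det_mx00.
  by rewrite card_prod card_ord.
pose f (s : T + 'I_n * T) : 'I_n.+1 * T :=
  match s with inl x => (ord0, x) | inr (i, x) => (lift ord0 i, x) end.
pose f' (p : 'I_n.+1 * T) : T + 'I_n * T :=
  if unlift ord0 p.1 is Some i then inr (i, p.2) else inl p.2.
rewrite (@det_fmx_bij _ _ _ f); last first.
  exists f'.
    by case=> [x|[i x]]; rewrite /f' /f /= ?unlift_none ?liftK.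
  by case=> i x; rewrite /f' /f /=; case: unliftP => [j|] ->.
rewrite det_fmx_sum /copies /=.
set B := (X in block_mx _ X _ _); have -> : B = 0.
  by apply/matrixP => i j; rewrite !mxE; case: (enum_val j).
rewrite det_lblock exprS -IHn.
congr (_ * \det _).
by apply: eq_fmx => -[i x] [j y]; rewrite /= (inj_eq lift_inj).
Qed.

Lemma det_fmx_copies (S T : finType) (M : T -> T -> R) :
  \det (fmx (copies (S := S) M)) =
  \det (fmx M) ^+ #|S|.
Proof.
rewrite -det_fmx_copies_ord.
rewrite (@det_fmx_bij _ _ _ (fun p : 'I_#|S| * T => (enum_val p.1, p.2))).
  congr (\det _); apply: eq_fmx => -[i x] [j y].
  by rewrite /copies /= (inj_eq enum_val_inj).
exists (fun p : S * T => (enum_rank p.1, p.2)) => -[i x] /=.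
  by rewrite enum_valK.
by rewrite enum_rankK.
Qed.

End DetReindex.

(** * Schur complements, Sylvester's identity and split pencils *)

Lemma det_schur_dr (F : comUnitRingType) m n (A : 'M[F]_m) B C (D : 'M[F]_n) :
  D \in unitmx ->
  \det (block_mx A B C D) = \det D * \det (A - B *m invmx D *m C).
Proof.
move=> Du.
have -> : block_mx A B C D =
    block_mx (A - B *m invmx D *m C) (B *m invmx D) 0 1%:M
    *m block_mx 1%:M 0 C D.
  rewrite mulmx_block !mulmx1 !mulmx0 !mul1mx !add0r subrK.
  by rewrite -mulmxA mulVmx // mulmx1.
by rewrite det_mulmx det_ublock det_lblock !det1 mulr1 mul1r mulrC.
Qed.

Lemma det_schur_ul (F : comUnitRingType) m n (A : 'M[F]_m) B C (D : 'M[F]_n) :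
  A \in unitmx ->
  \det (block_mx A B C D) = \det A * \det (D - C *m invmx A *m B).
Proof.
move=> Au.
have -> : block_mx A B C D =
    block_mx A 0 C 1%:M
    *m block_mx 1%:M (invmx A *m B) 0 (D - C *m invmx A *m B).
  rewrite mulmx_block !mulmx1 !mulmx0 !mul1mx mul0mx !addr0.
  by rewrite !mulmxA mulmxV // mul1mx addrC subrK.
by rewrite det_mulmx det_lblock det_ublock !det1 mulr1 mul1r.
Qed.

(* Both sides are the two Schur complement expansions of
   [[a I, B], [C, a I]]. *)
Lemma det_sylvester (F : fieldType) m n (a : F) (B : 'M[F]_(m, n)) C :
  a != 0 ->
  a ^+ m * \det (a%:M - a^-1 *: (C *m B)) =
  a ^+ n * \det (a%:M - a^-1 *: (B *m C)).
Proof.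
move=> a0; have au k : (a%:M : 'M[F]_k) \in unitmx.
  by rewrite unitmxE det_scalar unitfE expf_neq0.
transitivity (\det (block_mx a%:M B C a%:M)).
  rewrite det_schur_ul // det_scalar invmx_scalar.
  by rewrite -mulmxA mul_scalar_mx scalemxAr.
rewrite det_schur_dr // det_scalar invmx_scalar.
by rewrite -mulmxA mul_scalar_mx scalemxAr.
Qed.

(** For nonzero [b] the determinant is b^n times the characteristic polynomial of [A] evaluated at
    [a / b]. The morphism [f] is there because the eigenvalues lie in the base field while [a] and
    [b] will be rational functions. *)
Lemma det_split_pencil (K F : fieldType) (f : {rmorphism K -> F}) n
    (A : 'M[K]_n) (lam : 'I_n -> K) (a b : F) :
  eigenvalues_of A lam ->
  \det (a%:M - b *: map_mx f A) = \prod_j (a - b * f (lam j)).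
Proof.
move=> Alam; have [->|b0] := eqVneq b 0.
  rewrite scale0r subr0 det_scalar.
  under eq_bigr do rewrite mul0r subr0.
  by rewrite prodr_const card_ord.
have -> : a%:M - b *: map_mx f A = b *: ((a / b)%:M - map_mx f A).
  by rewrite scalerBr scale_scalar_mx mulrC divfK.
rewrite detZ.
have -> : \det ((a / b)%:M - map_mx f A) = (map_poly f (char_poly A)).[a / b].
  rewrite map_char_poly -horner_evalE -det_map_mx map_mxB /=.
  congr (\det (_ - _)); apply/matrixP => i j; rewrite !mxE.
    by rewrite horner_evalE hornerMn hornerX.
  by rewrite horner_evalE hornerC.
rewrite Alam rmorph_prod horner_prod.
rewrite -[n in b ^+ n]card_ord -prodr_const -big_split.
apply: eq_bigr => j _ /=.
by rewrite rmorphB /= map_polyX map_polyC hornerXsubC mulrBr mulrC divfK.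
Qed.

Lemma invmx_right (R : comUnitRingType) n (A B : 'M[R]_n) :
  A *m B = 1%:M -> invmx A = B.
Proof.
move=> AB; have [Au _] := mulmx1_unit AB.
by rewrite -[LHS]mulmx1 -AB mulKmx.
Qed.

Lemma fmx_rank (R : Type) (S T : finType) (A : 'M[R]_(#|S|, #|T|)) :
  fmx (fun x y => A (enum_rank x) (enum_rank y)) = A.
Proof. by apply/matrixP => i j; rewrite !mxE !enum_valK. Qed.

(** * The Gram matrix of an orientation *)

Section Incidence.
Variables (V : finType) (G : sigraph V).

Definition adjz (u v : V) : int := if adj G u v then sgn G u v else 0.

Lemma adjmxE (R : pzRingType) : adjmx R G = fmx (fun u v => (adjz u v)%:~R).
Proof. by apply/matrixP => i j; rewrite !mxE /adjz; case: ifP. Qed.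

Lemma edgesP (e : {set V}) :
  reflect (exists u v, adj G u v /\ e = [set u; v]) (e \in edges G).
Proof.
rewrite inE; apply: (iffP existsP) => [[u /existsP[v /andP[uv /eqP->]]]|].
  by exists u, v.
by move=> [u [v [uv ->]]]; exists u; apply/existsP; exists v; rewrite uv eqxx.
Qed.

Lemma edge_other_end (e : {set V}) v :
  e \in edges G -> v \in e -> exists2 w, adj G v w & e = [set v; w].
Proof.
move=> /edgesP[a [b [ab ->]]]; rewrite !inE => /orP[]/eqP->; first by exists b.
by exists a; rewrite 1?adj_sym // setUC.
Qed.

(** In a simple graph, sending a neighbour w of [v] to the edge {v, w} is a bijection onto the edges
    at [v]. *)
Lemma card_incident_edges v :
  #|[set e in edges G | v \in e]| = #|[set w | adj G v w]|.
Proof.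
have -> : [set e in edges G | v \in e]
    = [set [set v; w] | w in [set w | adj G v w]].
  apply/setP => e; rewrite [LHS]inE; apply/andP/imsetP => [[eE ve]|[w]].
    by have [w vw ->] := edge_other_end eE ve; exists w; rewrite ?inE.
  rewrite inE => vw ->; rewrite !inE eqxx; split=> //.
  by apply/existsP; exists v; apply/existsP; exists w; rewrite vw eqxx.
rewrite card_in_imset // => a b; rewrite !inE => va vb /setP/(_ a).
rewrite !inE eqxx orbT => /esym/orP[/eqP av|/eqP //].
by rewrite av adj_irr in va.
Qed.

Variable th : rorientation G.

(** This is B B^T = A + k I entrywise. On the diagonal, squared signs count the edges at [v]; off
    it, only the edge {v, w}, if there is one, meets both vertices, and it contributes its sign. *)
Lemma theta_gram k : regular G k -> forall v w,
  \sum_e th v e * th w e = adjz v w + k%:Z *+ (v == w).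
Proof.
move=> Gk v w; have [<-|vw] := eqVneq v w.
  rewrite /adjz adj_irr add0r mulr1n -(Gk v) -card_incident_edges.
  transitivity (\sum_(e : edge G) (v \in val e)%:Z).
    apply: eq_bigr => e _; case: (boolP (v \in val e)) => ve.
      by case: (theta_end th ve) => ->.
    by rewrite (theta_out th ve) mul0r.
  rewrite -(big_sub _ (fun e : {set V} => (v \in e)%:Z)) -sum1_card.
  rewrite (big_morph Posz PoszD (erefl 0%:Z)).
  rewrite (eq_bigl (fun e => (e \in edges G) && (v \in e))); last first.
    by move=> e; rewrite inE.
  by rewrite [RHS]big_mkcondr; apply: eq_bigr => e _; case: (v \in e).
rewrite mulr0n addr0 /adjz; case: ifP => [vwG|vwG].
  have eE : [set v; w] \in edges G by apply/edgesP; exists v, w.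
  rewrite (bigD1 (Sub [set v; w] eE : edge G)) //= (theta_sgn th vwG) //.
  rewrite big1 ?addr0 // => e ne.
  case: (boolP (v \in val e)) => ve; last by rewrite (theta_out th ve) mul0r.
  case: (boolP (w \in val e)) => we; last by rewrite (theta_out th we) mulr0.
  case/eqP: ne; apply: val_inj => /=.
  have [a va ee] := edge_other_end (valP e) ve.
  by move: we; rewrite ee !inE eq_sym (negPf vw) => /eqP->.
apply: big1 => e _.
case: (boolP (v \in val e)) => ve; last by rewrite (theta_out th ve) mul0r.
case: (boolP (w \in val e)) => we; last by rewrite (theta_out th we) mulr0.
have [a va ee] := edge_other_end (valP e) ve.
move: we; rewrite ee !inE eq_sym (negPf vw) => /eqP wa.
by rewrite wa va in vwG.
Qed.

End Incidence.

(** * The characteristic determinant of the corona *)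

Section CoronaDet.
Variables (F : fieldType) (V1 V2 : finType) (G1 : sigraph V1).
Variables (th : rorientation G1) (G2 : sgraph V2) (x : F).
Hypothesis x0 : x != 0.

Let N : 'M[F]_#|V2| := x%:M - adjmx F G2.
Hypothesis Nu : N \in unitmx.

Let s : F := ((markvec F G2)^T *m invmx N *m markvec F G2) 0 0.
Let B := fmx (fun v e => (th v e)%:~R : F).

Let N' u v : F := invmx N (enum_rank u) (enum_rank v).

Lemma coronal_sum :
  s = \sum_v (\sum_u (mark G2 u)%:~R * N' u v) * (mark G2 v)%:~R.
Proof.
rewrite /s !mxE [RHS]big_enum_val; apply: eq_bigr => j _; rewrite !mxE.
rewrite [in RHS]big_enum_val; congr (_ * _); apply: eq_bigr => i _.
by rewrite !mxE /N' !enum_valK.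
Qed.

Lemma charmxE (V : finType) (G : sigraph V) :
  x%:M - adjmx F G = fmx (fun u v => x *+ (u == v) - (adjz G u v)%:~R).
Proof. by rewrite adjmxE -fmx_scalar; apply/matrixP => i j; rewrite !mxE. Qed.

Lemma theta_mem (t : V1) (e : edge G1) (a : int) :
  (if t \in val e then th t e * a else 0) = th t e * a.
Proof. by case: ifPn => // te; rewrite (theta_out th te) mul0r. Qed.

Lemma det_corona :
  \det (x%:M - adjmx F (corona th G2)) =
  \det N ^+ #|V1| * (x ^+ #|V1|
    * \det (x%:M - (s + x^-1) *: (B^T *m B))).
Proof.
rewrite charmxE det_fmx_sum.
set A := (X in block_mx X); set Bd := (X in block_mx _ X).
set C := (X in block_mx _ _ X); set D := (X in block_mx _ _ _ X).
pose Nf u v : F := x *+ (u == v) - (adjz G2 u v)%:~R.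
have NE : N = fmx Nf by rewrite /N charmxE.
have DE : D = fmx (copies Nf).
  apply: eq_fmx => -[t u] [r v]; rewrite /copies /Nf /adjz /=.
  rewrite -[inr _ == inr _]/((t, u) == (r, v)) xpair_eqE.
  by case: eqVneq => _ //=; rewrite mulr0n subr0.
have N'E : fmx N' = invmx N by rewrite /N' fmx_rank.
(* I (x) N is inverted block by block. *)
have DV : D *m fmx (copies N') = 1%:M.
  rewrite DE mul_copies -fmx_scalar; apply: eq_fmx => -[t u] [r v].
  rewrite /copies /= xpair_eqE.
  have := mulmxV Nu; rewrite {1}NE -N'E mul_fmx -fmx_scalar => /matrixP.
  move=> /(_ (enum_rank u) (enum_rank v)); rewrite !mxE !enum_rankK => ->.
  by rewrite -mulrnA mulnb andbC.
have [Du _] := mulmx1_unit DV.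
rewrite det_schur_dr // (invmx_right DV) {1}DE det_fmx_copies -NE.
congr (_ * _).
(* [P] is the Schur complement of the copies block. Only its edge-edge part changes, since no vertex
   of the first graph is adjacent to a copy. *)
pose P (a b : subdiv_vertex G1) : F :=
  match a, b with
  | inl v, inl w => x *+ (v == w)
  | inl v, inr e | inr e, inl v => - (th v e)%:~R
  | inr e, inr f => x *+ (e == f) - s * \sum_t (th t e)%:~R * (th t f)%:~R
  end.
pose b (a : subdiv_vertex G1) (p : V1 * V2) : F :=
  if a is inr e then (th p.1 e)%:~R * (mark G2 p.2)%:~R else 0.
have BdE : Bd = fmx (fun a p => - b a p).
  apply: eq_fmx => -[v|e] [t u]; rewrite /adjz /= mulr0n sub0r //.
  by rewrite theta_mem intrM.
have CE : C = fmx (fun p a => - b a p).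
  apply: eq_fmx => -[t u] [v|e]; rewrite /adjz /= mulr0n sub0r //.
  by rewrite theta_mem intrM.
have -> : A - Bd *m fmx (copies N') *m C = fmx P.
  rewrite BdE CE !mul_fmx; apply/matrixP => i j; rewrite !mxE.
  case: (enum_val i) (enum_val j) => [v|e] [w|f] /=.
  - rewrite big1 => [|q _]; last by rewrite oppr0 mulr0.
    by rewrite /adjz /= !subr0.
  - rewrite big1 => [|q _].
      by rewrite /adjz /= mulr0n sub0r subr0 -[th v f]mulr1 theta_mem.
    by rewrite big1 ?mul0r // => p _; rewrite oppr0 mul0r.
  - rewrite big1 => [|q _]; last by rewrite oppr0 mulr0.
    by rewrite /adjz /= mulr0n sub0r subr0 -[th w e]mulr1 theta_mem.
  - rewrite /adjz /= subr0; congr (_ - _).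
    rewrite coronal_sum mulr_sumr.
    rewrite -(pair_bigA _ (fun t v => (\sum_p - ((th p.1 e)%:~R
      * (mark G2 p.2)%:~R) * copies N' p (t, v))
      * - ((th t f)%:~R * (mark G2 v)%:~R))) /=.
    apply: eq_bigr => t _; rewrite mulr_suml; apply: eq_bigr => v _.
    rewrite -(pair_bigA _ (fun r u => - ((th r e)%:~R * (mark G2 u)%:~R)
      * copies N' (r, u) (t, v))) /=.
    (* The inverse does not mix copies, so for each [t] only r = t survives and the marks sum to the
       coronal [s]. *)
    rewrite (bigD1 t) //= [X in _ + X]big1 ?addr0 => [|r /negPf rt]; last first.
      by apply: big1 => u _; rewrite /copies /= rt mulr0n mulr0.
    rewrite !mulr_suml; apply: eq_bigr => u _.
    by rewrite /copies /= eqxx mulr1n; ring.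
(* Second elimination: the vertex block is x I, whose complement subtracts a further x^-1 B^T B. *)
rewrite det_fmx_sum /= fmx_scalar det_schur_ul; last first.
  by rewrite unitmxE det_scalar unitfE expf_neq0.
rewrite det_scalar invmx_scalar; congr (_ * \det _).
rewrite -!mulmxA mul_scalar_mx -scalemxAr.
apply/matrixP => e f; rewrite !mxE (inj_eq enum_val_inj) mulrDl opprD addrA.
congr (_ - _ * _ - _ * _).
  by rewrite [LHS]big_enum_val; apply: eq_bigr => i _; rewrite !mxE.
by apply: eq_bigr => i _; rewrite !mxE mulrNN.
Qed.

Lemma det_corona_regular k : regular G1 k ->
  \det (x%:M - adjmx F (corona th G2)) =
  x ^ (#|edges G1|%:Z - #|V1|%:Z) * \det N ^+ #|V1|
  * \det ((x ^+ 2)%:M - (1 + x * s) *: (adjmx F G1 + k%:R%:M)).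
Proof.
move=> G1k; have BBt : B *m B^T = adjmx F G1 + k%:R%:M.
  rewrite fmx_tr mul_fmx adjmxE -fmx_scalar; apply/matrixP => i j; rewrite !mxE.
  transitivity ((\sum_e th (enum_val i) e * th (enum_val j) e)%:~R : F).
    by rewrite rmorph_sum; apply: eq_bigr => e _; rewrite -intrM.
  by rewrite (theta_gram th G1k) intrD; case: eqVneq.
rewrite det_corona -BBt.
(* The factor [x] in front of [s + x^-1] cancels the [a^-1] in Sylvester's identity. *)
have := det_sylvester ((x * (s + x^-1)) *: B) B^T x0.
rewrite -scalemxAr -scalemxAl !scalerA mulKf // => ->.
have -> : (x ^+ 2)%:M - (1 + x * s) *: (B *m B^T)
    = x *: (x%:M - (s + x^-1) *: (B *m B^T)).
  rewrite scalerBr scale_scalar_mx -expr2 scalerA mulrDr divff //.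
  by rewrite [1 + _]addrC.
rewrite detZ; set d := \det (x%:M - _ *: _); move: d => d.
rewrite card_sig (_ : #|[pred e | _]| = #|edges G1|); last exact: eq_card.
(* The exponent is an integer that may be negative: for k < 2 a nonempty graph has fewer edges than
   vertices. Splitting it uses that [x] is nonzero. *)
rewrite expfzDr // -exprnN -exprnP.
have xn0 : x ^+ #|V1| != 0 by rewrite expf_neq0.
by rewrite mulrCA -!mulrA [X in _ = _ * X]mulrCA mulKf.
Qed.

End CoronaDet.

(** * Passage to rational functions and conclusion *)

Lemma frac_char_poly (R : fieldType) n (A : 'M[R]_n) :
  (char_poly A)%:F = \det (('X%:F)%:M - map_mx (fun a : R => (a%:P)%:F) A).
Proof.
rewrite -det_map_mx; congr (\det _); apply/matrixP => i j.
by rewrite !mxE rmorphB rmorphMn.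
Qed.

Lemma map_adjmx (R S : pzRingType) (f : {rmorphism R -> S}) (V : finType)
    (G : sigraph V) :
  map_mx f (adjmx R G) = adjmx S G.
Proof.
by apply/matrixP => i j; rewrite !mxE; case: ifP; rewrite ?rmorph_int ?rmorph0.
Qed.

Theorem theorem5p1 (R : rcfType) (V1 V2 : finType)
    (G1 : sgraph V1) (gamma1 : nat) (th : rorientation G1) (G2 : sgraph V2)
    (lam : 'I_#|V1| -> R)
    (hreg : regular G1 gamma1)
    (hlam : eigenvalues_of (adjmx R G1) lam) :
  (char_poly (adjmx R (corona th G2)))%:F
  = 'X%:F ^ (#|edges G1|%:Z - #|V1|%:Z)
    * (char_poly (adjmx R G2))%:F ^+ #|V1|
    * \prod_(j < #|V1|)
        ('X%:F ^+ 2
         - (1 + 'X%:F * coronal G2 (adjmx R G2))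
           * (((lam j)%:P)%:F + gamma1%:R)).
Proof.
(* The determinant formula is applied over the field of rational functions, at the indeterminate;
   [phi] embeds the constants. *)
pose phi : {rmorphism R -> {fraction {poly R}}} :=
  (@FracField.tofrac _) \o (@polyC R).
have phiE : (fun a : R => (a%:P)%:F) = phi by [].
have x0 : 'X%:F != 0 :> {fraction {poly R}} by rewrite tofrac_eq0 polyX_eq0.
rewrite /coronal !frac_char_poly phiE !map_adjmx.
rewrite (det_corona_regular th x0 _ hreg); last first.
  (* X I - A2 is invertible because its determinant is a monic polynomial, hence nonzero. *)
  rewrite unitmxE unitfE -(map_adjmx phi) -frac_char_poly tofrac_eq0.
  by rewrite monic_neq0 // char_poly_monic.
congr (_ * _); set c := 1 + _.
(* Absorbing the degree into the scalar part gives the pencil (X^2 - c gamma1) I - c A1, which the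
   eigenvalues split. *)
rewrite scalerDr opprD addrCA scale_scalar_mx -rmorphN addrC -rmorphD /=.
rewrite -(map_adjmx phi) (det_split_pencil phi _ _ hlam).
by apply: eq_bigr => j _ /=; rewrite mulrDr opprD addrA addrAC.
Qed.
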